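(* Let $\widetilde{G}$ be a mixed graph. Then $$m(\widetilde{G})-c(\widetilde{G}) \leq p^{+}(\widetilde{G}) \leq m(\widetilde{G})+c(\widetilde{G}),\qquad m(\widetilde{G})-c(\widetilde{G}) \leq n^{-}(\widetilde{G}) \leq m(\widetilde{G})+c(\widetilde{G}).$$
   Context: All graphs are finite, without loops or multiple edges. A mixed graph $\widetilde{G}$ is obtained from an undirected graph $G$ (its underlying graph) by orienting some of the edges of $G$. If $\widetilde{G}$ has vertices $v_1,\dots,v_n$, its Hermitian adjacency matrix is the $n\times n$ matrix $H(\widetilde{G})=(h_{kl})$ with $h_{kl}=-h_{lk}=\mathbf{i}$ (the imaginary unit) if there is an arc from $v_k$ to $v_l$, $h_{kl}=h_{lk}=1$ if $v_k,v_l$ are joined by an undirected edge, and $h_{kl}=0$ otherwise. $H(\widetilde{G})$ is Hermitian; $p^{+}(\widetilde{G})$ and $n^{-}(\widetilde{G})$ denote the numbers of positive and negative eigenvalues of $H(\widetilde{G})$ (with multiplicity). The matching number $m(\widetilde{G})$ is the maximum cardinality of a matching of the underlying graph $G$, and $c(\widetilde{G})=|E(G)|-|V(G)|+\omega(G)$ is the dimension of the cycle space of $G$, where $\omega(G)$ is the number of connected components of $G$. *)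

(* Defs.v *)
From mathcomp Require Import all_boot all_order all_algebra.
Set Implicit Arguments.
Unset Strict Implicit.
Unset Printing Implicit Defensive.
Import Order.TTheory GRing.Theory Num.Theory.
Local Open Scope ring_scope.

(* [adj] is the adjacency relation of the underlying simple graph, and
   [oriented x y] says that its edge xy is oriented from x to y. *)
Record mixed_graph (V : finType) := MixedGraph {
  adj : rel V;
  oriented : rel V;
  adj_sym : symmetric adj;
  adj_irr : irreflexive adj;
  oriented_adj : subrel oriented adj;
  oriented_asym : forall x y, oriented x y -> ~~ oriented y x
}.

Section MixedGraph.
Variables (V : finType) (G : mixed_graph V).

Definition edges : {set {set V}} := [set [set x; y] | x in V, y in adj G x].

Definition is_matching (M : {set {set V}}) : bool :=
  (M \subset edges) && trivIset M.

Definition matching_number : nat :=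
  \max_(M : {set {set V}} | is_matching M) #|M|.

Definition components : nat := n_comp (adj G) V.

Definition cyclomatic : int := #|edges|%:Z - #|V|%:Z + components%:Z.

Definition hentry (C : numClosedFieldType) (x y : V) : C :=
  if oriented G x y then 'i
  else if oriented G y x then - 'i
  else if adj G x y then 1
  else 0.

Definition hermitian_adj (C : numClosedFieldType) : 'M[C]_#|V| :=
  \matrix_(i, j) hentry C (enum_val i) (enum_val j).

End MixedGraph.

(* The roots of the characteristic polynomial, repeated according to their
   multiplicity. *)
Definition eigenvalues (C : numClosedFieldType) n (A : 'M[C]_n) : seq C :=
  sval (closed_field_poly_normal (char_poly A)).

Lemma eigenvaluesP (C : numClosedFieldType) n (A : 'M[C]_n) :
  char_poly A = \prod_(z <- eigenvalues A) ('X - z%:P).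
Proof.
have := svalP (closed_field_poly_normal (char_poly A)).
by rewrite -/(eigenvalues A) (monicP (char_poly_monic A)) scale1r.
Qed.

(* In a numClosedFieldType [0 < z] holds only for real z. *)
Definition pos_inertia (C : numClosedFieldType) n (A : 'M[C]_n) : nat :=
  count (fun z => 0 < z) (eigenvalues A).

Definition neg_inertia (C : numClosedFieldType) n (A : 'M[C]_n) : nat :=
  count (fun z => z < 0) (eigenvalues A).

(* Main.v *)
(* A spanning forest leaves c non-forest edges; one endpoint of each gives a
   set X with |X| <= c such that G - X is a subgraph of the forest. Stripping
   leaves of G - X produces edges v_i y_i (i < k) forming a matching, with
   v_i not adjacent to y_j for i < j, such that X together with the y_i covers
   all edges of G. Hence k <= m <= k + |X|, and it remains to see that
   k <= p <= k + |X|.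
   A positive definite subspace meets the totally isotropic subspace of the
   vectors supported outside the cover trivially, so p <= k + |X|. Conversely,
   the v_i are independent and T = (A v_i y_j) is triangular with nonzero
   diagonal, so the block [0 T; T* D], where D = (A y_i y_j), carries the
   k-dimensional positive definite subspace spanned by the rows of
   [(1 - D/2) T^-1, 1].
   Both arguments use only the zero pattern of a Hermitian matrix A, so applying
   them to - H gives the bounds on n. *)
Require Import Defs.
From mathcomp Require Import all_boot all_order all_algebra.
From mathcomp Require Import complex reals ring zify.
Import Order.TTheory GRing.Theory Num.Theory.
Local Open Scope ring_scope.
Local Open Scope complex_scope.
Local Open Scope sesquilinear_scope.

(** * Spectral theorem and inertia of Hermitian matrices *)

Lemma hermitian_diagonalization {C : numClosedFieldType} n (A : 'M[C]_n) :
    A^t* = A ->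
  exists (P : 'M[C]_n) (d : 'rV[C]_n),
    [/\ P \is unitarymx, A = P^t* *m diag_mx d *m P
      & forall i, d 0 i \is Num.real].
Proof.
move=> Aherm; have Ah : A \is hermsymmx.
  by apply/is_hermitianmxP; rewrite expr0 scale1r Aherm.
exists (spectralmx A), (spectral_diag A); split.
- exact: spectral_unitarymx.
- rewrite -invmx_unitary ?spectral_unitarymx //.
  exact/orthomx_spectralP/hermitian_normalmx.
- by move=> i; apply: (mxOverP (hermitian_spectral_diag_real Ah)).
Qed.

Lemma char_poly_conj {F : fieldType} n (P A : 'M[F]_n) :
  P \in unitmx -> char_poly (invmx P *m A *m P) = char_poly A.
Proof.
move=> Pu; rewrite /char_poly /char_poly_mx.
have QP : map_mx polyC (invmx P) *m map_mx polyC P = 1%:M.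
  by rewrite -map_mxM /= mulVmx // map_mx1.
have -> : 'X%:M - map_mx polyC (invmx P *m A *m P) =
    map_mx polyC (invmx P) *m ('X%:M - map_mx polyC A) *m map_mx polyC P.
  by rewrite mulmxBr mulmxBl !map_mxM /= scalar_mxC -(mulmxA 'X%:M) QP mulmx1.
rewrite !det_mulmx mulrAC -det_mulmx QP det1; exact: mul1r.
Qed.

(** The order of the roots in [eigenvalues] is unspecified, so they are compared up to permutation,
    through the linear factors of the characteristic polynomial. *)
Lemma perm_eigenvalues {C : numClosedFieldType} n (P : 'M[C]_n) (d : 'rV_n) :
    P \is unitarymx ->
  perm_eq (eigenvalues (P^t* *m diag_mx d *m P)) [seq d 0 i | i : 'I_n].
Proof.
move=> Pu; apply: prod_XsubC_eq; rewrite -eigenvaluesP.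
rewrite -invmx_unitary // char_poly_conj ?unitarymx_unit //.
rewrite char_poly_trig ?diag_mx_is_trig // big_map big_enum.
by apply: eq_bigr => i _; rewrite !mxE eqxx.
Qed.

Lemma pos_inertia_diag {C : numClosedFieldType} n (P : 'M[C]_n) (d : 'rV_n) :
    P \is unitarymx ->
  pos_inertia (P^t* *m diag_mx d *m P) = #|[set i | 0 < d 0 i]|.
Proof.
move=> Pu; rewrite /pos_inertia (permP (perm_eigenvalues _ _ _ Pu)) count_map.
rewrite cardE {2}/enum_mem size_filter -enumT.
by apply: eq_count => i /=; rewrite inE.
Qed.

Lemma neg_inertia_opp {C : numClosedFieldType} n (A : 'M[C]_n) :
  A^t* = A -> neg_inertia A = pos_inertia (- A).
Proof.
move=> /hermitian_diagonalization[P [d [Pu -> _]]].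
rewrite -mulNmx -mulmxN -raddfN pos_inertia_diag //.
rewrite /neg_inertia (permP (perm_eigenvalues _ _ _ Pu)) count_map.
rewrite cardE {2}/enum_mem size_filter -enumT.
by apply: eq_count => i /=; rewrite inE mxE oppr_gt0.
Qed.

(** The columns of [U] indexed by [S] have trivial left kernel, hence rank [k]. This is the
    dimension count behind both inertia bounds. *)
Lemma leq_card_supp {F : fieldType} k n (U : 'M[F]_(k, n)) (S : {set 'I_n}) :
    (forall w : 'rV_k, (forall i, i \in S -> (w *m U) 0 i = 0) -> w = 0) ->
  (k <= #|S|)%N.
Proof.
move=> U0; set f := enum_val : 'I_#|S| -> 'I_n.
have /eqP <- : row_free (colsub f U); last exact: rank_leq_col.
apply: inj_row_free => w wU0; apply: U0 => i Si.
have /rowP/(_ (enum_rank_in Si i)) := wU0.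
by rewrite mulmx_colsub mxE [RHS]mxE /f enum_rankK_in.
Qed.

Lemma diag_form {C : numClosedFieldType} n (d u : 'rV[C]_n) :
  (u *m diag_mx d *m u^t*) 0 0 = \sum_i `|u 0 i| ^+ 2 * d 0 i.
Proof.
rewrite mxE; apply: eq_bigr => i _; rewrite mul_mx_diag !mxE normCK.
by rewrite mulrAC.
Qed.

(** In eigenbasis coordinates, a vector that vanishes at every positive eigenvalue has a nonpositive
    form, so a positive definite subspace contains no such vector but 0. *)
Lemma leq_pos_inertia {C : numClosedFieldType} k n (A : 'M[C]_n)
    (U : 'M[C]_(k, n)) :
    A^t* = A ->
    (forall w : 'rV_k, w != 0 -> 0 < (w *m (U *m A *m U^t*) *m w^t*) 0 0) ->
  (k <= pos_inertia A)%N.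
Proof.
move=> /hermitian_diagonalization[P [d [Pu -> dR]]] Upos.
rewrite pos_inertia_diag //; apply: (@leq_card_supp _ _ _ (U *m P^t*)).
move=> w w0; apply: contraTeq isT => /Upos; set x := w *m (U *m P^t*) in w0 *.
have -> : w *m (U *m (P^t* *m diag_mx d *m P) *m U^t*) *m w^t* =
    x *m diag_mx d *m x^t*.
  by rewrite /x !trmx_mul !map_mxM /= trmxCK !mulmxA.
(* Rewriting the goal [false] backwards turns it into nonpositivity of the form. *)
rewrite diag_form /= => /lt_geF <-; apply: sumr_le0 => i _.
have [/w0 ->|] := boolP (i \in [set i | 0 < d 0 i]).
  by rewrite normr0 expr0n mul0r.
rewrite inE -real_leNgt ?real0 // => d0.
by rewrite mulr_ge0_le0 ?exprn_ge0.
Qed.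

Lemma unitary_form {C : numClosedFieldType} n (P D : 'M[C]_n) (u : 'rV[C]_n) :
    P \is unitarymx ->
  u *m P *m (P^t* *m D *m P) *m (u *m P)^t* = u *m D *m u^t*.
Proof.
by move=> Pu; rewrite trmx_mul map_mxM /= !mulmxA mulmxtVK // mulmxtVK.
Qed.

Lemma pos_inertia_leq {C : numClosedFieldType} n (A : 'M[C]_n)
    (S : {set 'I_n}) :
    A^t* = A -> (forall i j, i \notin S -> j \notin S -> A i j = 0) ->
  (pos_inertia A <= #|S|)%N.
Proof.
move=> /hermitian_diagonalization[P [d [Pu -> dR]]] A0.
rewrite pos_inertia_diag //; set D := [set i | 0 < d 0 i].
(* The rows of [E *m P] are the eigenvectors with positive eigenvalue. *)
pose E : 'M[C]_(#|D|, n) := \matrix_(i, j) (enum_val i == j)%:R.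
have wE (w : 'rV_#|D|) i : (w *m E) 0 (enum_val i) = w 0 i.
  rewrite mxE (bigD1 i) //= mxE eqxx mulr1 big1 ?addr0 // => j /negPf ji.
  by rewrite mxE (inj_eq enum_val_inj) ji mulr0.
have wE0 (w : 'rV_#|D|) i : i \notin D -> (w *m E) 0 i = 0.
  move=> Di; rewrite mxE big1 // => j _; rewrite mxE.
  by case: eqP => [ij|]; rewrite ?mulr0 //; move: Di; rewrite -ij enum_valP.
apply: (@leq_card_supp _ _ _ (E *m P)) => w.
rewrite mulmxA; set x := w *m E in wE wE0 *; move=> w0.
(* In the original basis the vector is [x *m P], which vanishes on [S], while [A] vanishes on pairs
   outside [S]. *)
have : (x *m diag_mx d *m x^t*) 0 0 = 0.
  rewrite -(unitary_form _ _ _ _ Pu).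
  rewrite mxE big1 // => j _; rewrite mxE.
  have [/w0 xj|Sj] := boolP (j \in S).
    by rewrite [_^t* _ _]mxE [_^T _ _]mxE xj conjC0 mulr0.
  rewrite big1 ?mul0r // => i _.
  have [/w0 ->|Si] := boolP (i \in S); first by rewrite mul0r.
  by rewrite A0 ?mulr0.
rewrite diag_form => /eqP; rewrite psumr_eq0 => [/allP/= x0|i _].
  apply/rowP => i; rewrite [RHS]mxE -wE.
  have := x0 (enum_val i); rewrite mem_index_enum mulf_eq0 expf_eq0 /= normr_eq0.
  move=> /(_ isT)/orP[/eqP//|/eqP d0].
  by have := enum_valP i; rewrite inE d0 ltxx.
have [|/wE0 ->] := boolP (i \in D).
  by rewrite inE => /ltW d0; rewrite mulr_ge0 ?exprn_ge0.
by rewrite normr0 expr0n mul0r.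
Qed.

Lemma leq_pos_inertia_trig {C : numClosedFieldType} k n (A : 'M[C]_n)
    (f g : 'I_k -> 'I_n) :
    A^t* = A ->
    (forall i j, A (f i) (f j) = 0) ->
    (forall i, A (f i) (g i) != 0) ->
    (forall i j : 'I_k, (i < j)%N -> A (f i) (g j) = 0) ->
  (k <= pos_inertia A)%N.
Proof.
move=> Aherm Aff Aii Atrig.
pose T := mxsub f g A; pose D := mxsub g g A.
have Tu : T \in unitmx.
  rewrite unitmxE det_trig; last first.
    by apply/is_trig_mxP => i j ij; rewrite mxE Atrig.
  by rewrite unitfE; apply/prodf_neq0 => i _; rewrite mxE.
have Dh : D^t* = D.
  by apply/matrixP => i j; rewrite !mxE -[in RHS]Aherm !mxE.
have Tt : mxsub g f A = T^t*.
  by apply/matrixP => i j; rewrite !mxE -[in LHS]Aherm !mxE.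
(* On the rows of [M *m E f + E g] the form is [M T + T^* M^* + D]; the choice [M T = 1 - D / 2]
   makes it twice the identity. *)
pose h : C := 2%:R^-1.
pose M := (1%:M - h *: D) *m invmx T.
pose E (r : 'I_k -> 'I_n) : 'M[C]_(k, n) := rowsub r 1%:M.
have AE r s : E r *m A *m (E s)^t* = mxsub r s A.
  apply/matrixP => i j; rewrite /E -rowsubE.
  rewrite mxE (bigD1 (s j)) //= !mxE eqxx conjC1 mulr1 big1 ?addr0 // => l sl.
  by rewrite !mxE eq_sym (negPf sl) conjC0 mulr0.
clearbody E.
have hR : (h^*)%R = h by rewrite /h fmorphV /= conjC_nat.
have MT : M *m T = 1%:M - h *: D by rewrite /M mulmxKV.
clearbody M.
have TM : T^t* *m M^t* = 1%:M - h *: D.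
  rewrite -map_mxM -trmx_mul MT raddfB /= trmx1 map_mxB map_mx1 linearZ /=.
  by rewrite map_mxZ /= hR Dh.
have form1 : (M *m E f + E g) *m A *m (M *m E f + E g)^t* = 2%:R *: 1%:M.
  rewrite raddfD /= map_mxD !mulmxDl !mulmxDr trmx_mul map_mxM /=.
  have -> : M *m E f *m A *m ((E f)^t* *m M^t*) = 0.
    rewrite -!mulmxA (mulmxA A) (mulmxA (E f)) (mulmxA (E f)) AE.
    have -> : mxsub f f A = 0 by apply/matrixP => i j; rewrite !mxE Aff.
    by rewrite mul0mx mulmx0.
  rewrite -!mulmxA (mulmxA (E f)) AE MT.
  rewrite (mulmxA A) (mulmxA (E g)) (mulmxA (E g)) AE Tt TM.
  rewrite (mulmxA (E g)) AE -/D add0r.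
  apply/matrixP => i j; rewrite !mxE.
  by rewrite /h; field.
apply: (@leq_pos_inertia _ _ _ _ (M *m E f + E g)) => // w w0.
rewrite form1 -scalemxAr mulmx1 -scalemxAl mxE mulr_gt0 ?ltr0n //.
have := diag_form _ (const_mx 1) w; rewrite diag_const_mx mulmx1 => ->.
rewrite lt_def sumr_ge0 ?andbT; last first.
  by move=> i _; rewrite mxE mulr1 exprn_ge0.
apply: contraNneq w0 => /eqP; rewrite psumr_eq0 => [/allP/= x0|i _]; last first.
  by rewrite mxE mulr1 exprn_ge0.
apply/eqP/rowP => i; have := x0 i (mem_index_enum _).
by rewrite !mxE mulr1 expf_eq0 /= normr_eq0 => /eqP.
Qed.

(** * Spanning forests, leaf elimination and vertex covers *)

Lemma edgesP (V : finType) (G : mixed_graph V) (B : {set V}) :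
  reflect (exists x y, adj G x y /\ B = [set x; y]) (B \in edges G).
Proof.
apply: (iffP imset2P) => [[x y _ xy ->]|[x [y [xy ->]]]].
  by exists x, y.
by exists x y.
Qed.

(** [h x] is the distance from [x] to the root of its component; the vertex before [x] on a shortest
    path from the root is a neighbour of smaller height. *)
Lemma exists_parent (V : finType) (e : rel V) :
    symmetric e ->
  exists (h : V -> nat) (par : V -> V),
    forall x, x \notin roots e -> e (par x) x /\ (h (par x) < h x)%N.
Proof.
move=> e_sym; have eC := sym_connect_sym e_sym.
(* Quantifying over tuples keeps the predicate boolean, as [ex_minn] requires. *)
pose at_dist x n := [exists t : n.-tuple V,
  path e (fingraph.root e x) t && (last (fingraph.root e x) t == x)].
have at_distP x p : path e (fingraph.root e x) p ->
    last (fingraph.root e x) p = x -> at_dist x (size p).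
  by move=> ep px; apply/existsP; exists (in_tuple p); rewrite ep px eqxx.
have exd x : exists n, at_dist x n.
  have : connect e (fingraph.root e x) x by rewrite eC connect_root.
  by move=> /connectP[p ep /esym px]; exists (size p); apply: at_distP.
pose h x := ex_minn (exd x).
have hmin x n : at_dist x n -> (h x <= n)%N.
  by rewrite /h; case: ex_minnP => m _; apply.
pose par x := odflt x [pick y | e y x && (h y < h x)%N].
exists h, par => x; rewrite inE => rx; rewrite /par; case: pickP => [y /andP//|].
suff [y eyx hy] : exists2 y, e y x & (h y < h x)%N.
  by move=> /(_ y); rewrite eyx hy.
have: at_dist x (h x) by rewrite /h; case: ex_minnP.
move: (h x) => n /existsP[t /andP[]] /=.
have := size_tuple t; case: (tval t) / lastP => [_ _ /= /eqP rxx|p z <-].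
  by rewrite /roots rxx eqxx in rx.
rewrite rcons_path last_rcons size_rcons => /andP[ep ez] /eqP zx.
rewrite {}zx in ez; exists (last (fingraph.root e x) p) => //.
rewrite ltnS; apply: hmin.
(* The height of the previous vertex is measured from the same root, so the shortened path bounds
   it. *)
have ry : fingraph.root e (last (fingraph.root e x) p) = fingraph.root e x.
  rewrite -[RHS]root_root //; apply/esym/(fingraph.rootP eC)/connectP.
  by exists p.
by apply: at_distP; rewrite ry.
Qed.

(** One element is picked from each member of [E]. The choice stays in [option V], since [V] may be
    empty. *)
Lemma exists_transversal (V : finType) (E : {set {set V}}) :
    set0 \notin E ->
  exists2 X : {set V}, (#|X| <= #|E|)%N
    & forall B, B \in E -> exists2 x, x \in B & x \in X.
Proof.
move=> E0; pose f (B : {set V}) := [pick x in B].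
exists [set x | Some x \in f @: E].
  rewrite -(card_imset _ (@Some_inj _)); apply: leq_trans (leq_imset_card f E).
  by apply/subset_leq_card/subsetP => _ /imsetP[x + ->]; rewrite inE.
move=> B EB; have : f B \in f @: E by apply: imset_f.
rewrite {1}/f; case: pickP => [x Bx fx|B0]; first by exists x; rewrite ?inE.
suff B_0 : B = set0 by move: E0; rewrite -B_0 EB.
by apply/setP => x; rewrite B0 inE.
Qed.

(* [h] is the distance to the root of the component in a spanning forest and
   [par] the parent map, so the conclusion says that every edge avoiding [X] is a
   forest edge. *)
Lemma exists_feedback (V : finType) (G : mixed_graph V) :
  exists (X : {set V}) (h : V -> nat) (par : V -> V),
    (#|X|%:Z <= cyclomatic G) /\
    forall x y, x \notin X -> y \notin X -> adj G x y ->
      (h y <= h x)%N -> y = par x.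
Proof.
have [h [par hpar]] := exists_parent _ (adj G) (adj_sym G).
pose D := [set x | x \notin roots (adj G)].
pose t x := [set x; par x].
have tE : t @: D \subset edges G.
  apply/subsetP => _ /imsetP[x + ->]; rewrite inE => /hpar[xp _].
  by apply/edgesP; exists x, (par x); rewrite adj_sym.
(* Two distinct vertices with the same parent edge would be each other's parents, each of smaller
   height than the other. *)
have tI : {in D &, injective t}.
  move=> x y; rewrite !inE => /hpar[_ hx] /hpar[_ hy] txy.
  have : x \in t y by rewrite -txy !inE eqxx.
  have : y \in t x by rewrite txy !inE eqxx.
  rewrite !inE => /orP[/eqP//|/eqP yx] /orP[/eqP//|/eqP xy].
  by move: hx hy; rewrite -xy -yx => /ltn_trans /[apply]; rewrite ltnn.
(* The forest has one edge per non-root, so [cyclomatic G] counts the remaining edges, and [X] hits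
   each of them. *)
have [|X leX hitX] := @exists_transversal _ (edges G :\: t @: D).
  apply/negP; rewrite inE => /andP[_ /edgesP[x [y [_ /setP/(_ x)]]]].
  by rewrite !inE eqxx.
exists X, h, par; split=> [|x y Xx Xy xy hyx].
  have cD : (#|D| + components G = #|V|)%N.
    rewrite -(cardC (roots (adj G))) addnC; congr (_ + _)%N.
      by apply: eq_card => x; rewrite !inE andbT.
    by apply: eq_card => x; rewrite !inE.
  have leD : (#|D| <= #|edges G|)%N.
    by rewrite -(card_in_imset tI) subset_leq_card.
  have leXD : (#|X| <= #|edges G| - #|D|)%N.
    by apply: leq_trans leX _; rewrite cardsD (setIidPr tE) card_in_imset.
  by rewrite /cyclomatic; lia.
have [/imsetP[z + xyz]|txy] := boolP ([set x; y] \in t @: D); last first.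
  have [|z] := hitX [set x; y].
    by rewrite inE txy; apply/edgesP; exists x, y.
  by rewrite !inE => /orP[/eqP->|/eqP->]; rewrite ?(negPf Xx) ?(negPf Xy).
(* The edge joins [z] to its parent; [hyx] excludes [y = z], leaving [x = z]. *)
rewrite inE => /hpar[_ hz].
have xNy : x != y by apply: contraTneq xy => ->; rewrite adj_irr.
have : x \in t z by rewrite -xyz !inE eqxx.
have : y \in t z by rewrite -xyz !inE eqxx orbT.
rewrite !inE => /orP[]/eqP yz /orP[]/eqP xz; last by rewrite xz yz eqxx in xNy.
- by rewrite xz yz eqxx in xNy.
- by move: hyx; rewrite yz xz leqNgt hz.
by rewrite xz.
Qed.

(** A vertex [v] of maximal height has at most one neighbour [y] in [S]. If [y] exists, both are
    removed, the pair is recorded and [y] joins [Y]; otherwise [v] alone is removed. The condition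
    on [cover M] keeps the new edge disjoint from the earlier matching. *)
Lemma exists_leaf_elimination (V : finType) (G : mixed_graph V)
    (h : V -> nat) (par : V -> V) (S : {set V}) :
    {in S &, forall x y, adj G x y -> (h y <= h x)%N -> y = par x} ->
  exists (s : seq (V * V)) (Y : {set V}),
    [/\ forall q, q \in s ->
          [/\ adj G q.1 q.2, q.1 \in S :\: Y & q.2 \in Y],
        pairwise (fun q r => ~~ adj G q.1 r.2) s,
        Y \subset S /\ (#|Y| <= size s)%N,
        {in S :\: Y &, forall x y, ~~ adj G x y}
      & exists M, [/\ is_matching G M, #|M| = size s & cover M \subset S]].
Proof.
have [n] := ubnP #|S|; elim: n S => // n IHn S leSn parS.
have [->|[v0 Sv0]] := set_0Vmem S.
  exists [::], set0; split=> //; first by rewrite sub0set cards0.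
    by move=> x y; rewrite !inE.
  exists set0; rewrite /is_matching sub0set cards0 /cover big_set0 sub0set.
  by split=> //; apply/trivIsetP => A B; rewrite inE.
(* Only the parent of a vertex of maximal height can be adjacent to it. *)
case: (@arg_maxnP _ v0 (mem S) h Sv0) => v; rewrite /= => Sv hv.
have nb y : y \in S -> adj G v y -> y = par v.
  by move=> Sy vy; apply: parS (hv _ Sy).
have [/existsP[y /andP[Sy vy]]|iso] := boolP [exists y, (y \in S) && adj G v y].
  have yE z : z \in S -> adj G v z -> z = y.
    by move=> Sz vz; rewrite (nb y) // (nb z).
  have vNy : v != y by apply: contraTneq vy => <-; rewrite adj_irr.
  pose S' := S :\: [set v; y].
  have sS'S : S' \subset S by apply: subsetDl.
  have S'v : v \notin S' by rewrite !inE eqxx.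
  have S'y : y \notin S' by rewrite !inE eqxx orbT.
  have [|x z S'x S'z|s [Y [sP sD [YS' Ys] indep [M [Mm Ms MS']]]]] := IHn S'.
  - apply: leq_trans (leSn : (#|S| <= n)%N); apply: proper_card.
    by apply/properP; split=> //; exists v.
  - by apply: parS; apply: (subsetP sS'S).
  have Yv : v \notin Y by apply: contra S'v; apply: (subsetP YS').
  have Yy : y \notin Y by apply: contra S'y; apply: (subsetP YS').
  exists ((v, y) :: s), (y |: Y); split.
  - move=> q; rewrite inE => /orP[/eqP->/=|/sP[q1 q2 q3]].
      by rewrite !inE eqxx negb_or vNy Yv Sv.
    split=> //; last by rewrite inE q3 orbT.
    move: q2; rewrite !inE => /and3P[qY /norP[_ qy] Sq].
    by rewrite negb_or qy qY Sq.
  (* The second components of the other pairs lie in [S'], which omits [y], the only neighbour of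
     [v] in [S]. *)
  - rewrite /= sD andbT; apply/allP => q /sP[_ _ /(subsetP YS') S'q] /=.
    apply/negP => vq; have qy := yE _ (subsetP sS'S _ S'q) vq.
    by rewrite qy (negPf S'y) in S'q.
  - split; last by rewrite cardsU1 Yy.
    by rewrite subUset sub1set Sy (subset_trans YS').
  - move=> a b; rewrite !in_setD !in_setU1 !negb_or.
    move=> /andP[/andP[ay aY] Sa] /andP[/andP[bNy bY] Sb].
    apply/negP => ab.
    have [av|av] := eqVneq a v.
      by rewrite av in ab; rewrite (yE b) ?eqxx in bNy.
    have [bv|bv] := eqVneq b v.
      by rewrite bv adj_sym in ab; rewrite (yE a) ?eqxx in ay.
    have /negP[//] : ~~ adj G a b.
    by apply: indep; rewrite !inE ?aY ?bY ?Sa ?Sb negb_or ?av ?bv ?ay ?bNy.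
  case/andP: Mm => ME Mt.
  have vyD : {in M, forall B : {set V}, [disjoint [set v; y] & B]}.
    move=> B MB; rewrite disjoint_sym; apply/pred0P => z /=.
    apply/negbTE/negP => /andP[Bz].
    have : z \in S'.
      by apply: (subsetP MS'); apply/bigcupP; exists B.
    by rewrite !inE => /andP[/negPf->].
  have M0 : set0 \notin M.
    apply/negP => /(subsetP ME)/edgesP[x [z [_ /setP/(_ x)]]].
    by rewrite !inE eqxx.
  have [vyM MU] := trivIsetU1 vyD Mt M0; exists ([set v; y] |: M); split.
  - rewrite /is_matching vyM andbT subUset sub1set ME andbT.
    by apply/edgesP; exists v, y.
  - by rewrite cardsU1 MU Ms.
  rewrite /cover bigcup_setU big_set1 subUset -/(cover M).
  rewrite (subset_trans MS') // andbT.
  by apply/subsetP => z; rewrite !inE => /orP[]/eqP->.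
(* Here [v] is isolated in [S], so the data for [S'] serve unchanged. *)
pose S' := S :\ v.
have sS'S : S' \subset S by apply: subsetDl.
have [|x z S'x S'z|s [Y [sP sD [YS' Ys] indep [M [Mm Ms MS']]]]] := IHn S'.
- apply: leq_trans (leSn : (#|S| <= n)%N); apply: proper_card.
  by apply: properD1.
- by apply: parS; apply: (subsetP sS'S).
exists s, Y; split=> //.
- by move=> q /sP[]; rewrite !inE => ? /and3P[-> _ ->].
- by split=> //; apply: subset_trans sS'S.
- move=> a b; rewrite !in_setD => /andP[Ya Sa] /andP[Yb Sb]; apply/negP => ab.
  have isoF z : z \in S -> adj G v z -> False.
    by move=> Sz vz; move/existsP: iso; case; exists z; rewrite Sz.
  have [av|av] := eqVneq a v; first by rewrite av in ab; apply: isoF ab.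
  have [bv|bv] := eqVneq b v.
    by rewrite bv adj_sym in ab; apply: isoF ab.
  have /negP[//] : ~~ adj G a b.
  by apply: indep; rewrite !inE ?Ya ?Yb ?Sa ?Sb ?av ?bv.
by exists M; split=> //; apply: subset_trans sS'S.
Qed.

(** Matching edges are disjoint and each contains a vertex of [K], so counting the vertices of [K]
    covered by the matching gives at least its size. *)
Lemma matching_leq_cover (V : finType) (G : mixed_graph V) (K : {set V}) :
    (forall x y, x \notin K -> y \notin K -> ~~ adj G x y) ->
  (matching_number G <= #|K|)%N.
Proof.
move=> Kcov; apply/bigmax_leqP => M /andP[/subsetP ME Mt].
have : (\sum_(x in cover M) (x \in K) <= #|K|)%N.
  rewrite -sum1_card [leqRHS]big_mkcond [leqLHS]big_mkcond.
  by apply: leq_sum => x _; do 2!case: (x \in _).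
apply: leq_trans; rewrite big_trivIset // -sum1_card.
apply: leq_sum => B /ME /edgesP[x [y [xy ->]]].
rewrite big_setU1 ?big_set1 /= ?inE; last first.
  by apply: contraTneq xy => ->; rewrite adj_irr.
case: (boolP (x \in K)) => // Kx; case: (boolP (y \in K)) => // Ky.
by have := Kcov _ _ Kx Ky; rewrite xy.
Qed.

(** * Comparing inertia with the matching number *)

(** [matching_number G] and [pos_inertia A] both lie between [size s] and [size s + #|X|], so they
    differ by at most [#|X|]. *)
Lemma inertia_matching_bounds {C : numClosedFieldType} (V : finType)
    (G : mixed_graph V) (A : 'M[C]_#|V|) :
    A^t* = A ->
    (forall x y, (A (enum_rank x) (enum_rank y) != 0) = adj G x y) ->
  (matching_number G)%:Z - cyclomatic G <= (pos_inertia A)%:Z /\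
  (pos_inertia A)%:Z <= (matching_number G)%:Z + cyclomatic G.
Proof.
move=> Aherm Aadj; have [X [h [par [leX parX]]]] := exists_feedback _ G.
have [|s [Y [sP sD [_ leY] indep [M [Mm Ms _]]]]] :=
    exists_leaf_elimination _ G h par (~: X).
  by move=> x y; rewrite !inE; apply: parX.
have XYcov x y : x \notin X :|: Y -> y \notin X :|: Y -> ~~ adj G x y.
  rewrite !inE !negb_or => /andP[Xx Yx] /andP[Xy Yy].
  by apply: indep; rewrite !inE ?Xx ?Yx ?Xy ?Yy.
have A0 x y : ~~ adj G x y -> A (enum_rank x) (enum_rank y) = 0.
  by rewrite -Aadj negbK => /eqP.
have m_ge : (size s <= matching_number G)%N.
  by rewrite -Ms; apply: leq_bigmax_cond.
have cXY : (#|X :|: Y| <= #|X| + size s)%N.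
  by rewrite (leq_trans (leq_card_setU _ _)) ?leq_add2l.
have m_le : (matching_number G <= #|X :|: Y|)%N by apply: matching_leq_cover.
have p_le : (pos_inertia A <= #|X :|: Y|)%N.
  rewrite -(card_imset _ enum_rank_inj); apply: pos_inertia_leq => // a b.
  rewrite -[a]enum_valK -[b]enum_valK !(mem_imset _ _ enum_rank_inj).
  by move=> Xa Xb; apply/A0/XYcov.
have p_ge : (size s <= pos_inertia A)%N.
  pose q := tnth (in_tuple s).
  have qP i : [/\ adj G (q i).1 (q i).2, (q i).1 \in ~: X :\: Y & (q i).2 \in Y].
    exact/sP/mem_tnth.
  apply: (@leq_pos_inertia_trig _ _ _ _ (fun i => enum_rank (q i).1)
            (fun i => enum_rank (q i).2)) => // [i j|i|i j ij].
  - by have [_ qi _] := qP i; have [_ qj _] := qP j; apply/A0/indep.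
  - by rewrite Aadj; have [] := qP i.
  apply: A0; have x0 := q i; rewrite /q !(tnth_nth x0) /=.
  by apply: (pairwiseP x0 sD); rewrite ?inE.
by split; lia.
Qed.

(** * Symmetry and zero pattern of the Hermitian adjacency matrix *)

Lemma hentry_conj (C : numClosedFieldType) (V : finType) (G : mixed_graph V)
  x y : ((hentry G C x y)^*)%R = hentry G C y x.
Proof.
rewrite /hentry adj_sym; case: (boolP (oriented G x y)) => [xy|_].
  by rewrite (negPf (oriented_asym xy)) conjCi.
case: (oriented G y x); first by rewrite rmorphN /= conjCi opprK.
by case: adj; rewrite ?conjC1 ?conjC0.
Qed.

Lemma hentry_neq0 (C : numClosedFieldType) (V : finType) (G : mixed_graph V)
  x y : (hentry G C x y != 0) = adj G x y.
Proof.
rewrite /hentry; case: ifP => [/oriented_adj->|_]; first by rewrite neq0Ci.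
case: ifP => [/oriented_adj|_]; first by rewrite adj_sym oppr_eq0 neq0Ci.
by case: adj; rewrite ?oner_eq0 ?eqxx.
Qed.

Theorem theorem3p6 (R : realType) (V : finType) (G : mixed_graph V) :
  let H := hermitian_adj G R[i] in
  let m : int := (matching_number G)%:Z in
  let c : int := cyclomatic G in
  let p : int := (pos_inertia H)%:Z in
  let n : int := (neg_inertia H)%:Z in
  (m - c <= p /\ p <= m + c) /\ (m - c <= n /\ n <= m + c).
Proof.
move=> H m c p n.
have Hherm : H^t* = H.
  by apply/matrixP => i j; rewrite !mxE; apply: hentry_conj.
have Hadj x y : (H (enum_rank x) (enum_rank y) != 0) = adj G x y.
  by rewrite mxE !enum_rankK hentry_neq0.
split; first exact: inertia_matching_bounds.
rewrite /n neg_inertia_opp //; apply: inertia_matching_bounds => [|x y].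
  by rewrite raddfN map_mxN Hherm.
by rewrite mxE oppr_eq0 Hadj.
Qed.
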